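(* Let $n\ge 3$ and let $s,t\in\{-1,1\}^{n}$ with $s\neq t$ and $\sharp_{n}(s)=\sharp_{n}(t)$. Let $(\beta_{1},\beta_{2})\in(0,1)^2$ satisfy $\beta_{1}+\beta_{2}>1$ and \[ \sum_{k=1}^{n}\Big(s_{k}\beta_{1}^{\sharp_{k}(s)}\beta_{2}^{\tilde\sharp_{k}(s)}-t_{k}\beta_{1}^{\sharp_{k}(t)}\beta_{2}^{\tilde\sharp_{k}(t)}\Big)=0 .\] Then there is a $p\in(0,1)$ such that $SD^{p}_{\beta_{1},\beta_{2}}>1$, but the measure $\mu^{p}_{\beta_{1},\beta_{2}}$ is singular (with respect to Lebesgue measure) and $\dim_{H}\mu^{p}_{\beta_{1},\beta_{2}}<1$.
   Context: For $\beta_{1},\beta_{2}\in(0,1)$ let $T_{1}(x)=\beta_{1}x+\beta_{1}$ and $T_{2}(x)=\beta_{2}x-\beta_{2}$ on $\mathbb{R}$. For $p\in(0,1)$, $\mu^{p}_{\beta_{1},\beta_{2}}$ denotes the unique Borel probability measure on $\mathbb{R}$ with $\mu^{p}_{\beta_{1},\beta_{2}}=p\,T_{1}(\mu^{p}_{\beta_{1},\beta_{2}})+(1-p)\,T_{2}(\mu^{p}_{\beta_{1},\beta_{2}})$, where $T_i(\mu)$ is the push-forward $\mu\circ T_i^{-1}$. The similarity dimension is \[ SD^{p}_{\beta_{1},\beta_{2}}=\frac{-p\log p-(1-p)\log(1-p)}{-p\log\beta_{1}-(1-p)\log\beta_{2}}.\] For $s\in\{-1,1\}^{n}$ and $1\le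 k\le n$, $\sharp_{k}(s)$ is the number of entries of $(s_{1},\dots,s_{k})$ equal to $1$ and $\tilde\sharp_{k}(s)=k-\sharp_{k}(s)$. Equivalently, $(\beta_1,\beta_2)$ lies on the algebraic curve $c_{s,t}=\{(x,y):\sum_{k=1}^{n}(s_{k}x^{\sharp_{k}(s)}y^{\tilde\sharp_{k}(s)}-t_{k}x^{\sharp_{k}(t)}y^{\tilde\sharp_{k}(t)})=0\}$. The Hausdorff dimension of a measure $\mu$ is $\dim_H\mu=\inf\{\dim_H A: A \text{ Borel}, \mu(A)=1\}$. *)

(* Defs.v *)
From HB Require Import structures.
From mathcomp Require Import all_boot all_order all_algebra.
From mathcomp Require Import all_classical all_reals all_analysis.
Set Implicit Arguments. Unset Strict Implicit. Unset Printing Implicit Defensive.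
Import Order.TTheory GRing.Theory Num.Theory.
Local Open Scope classical_set_scope.
Local Open Scope ring_scope.

Section Defs.
Variable R : realType.

Definition T1 (b1 : R) (x : R) : R := b1 * x + b1.
Definition T2 (b2 : R) (x : R) : R := b2 * x - b2.

Definition SD (p b1 b2 : R) : R :=
  (- p * ln p - (1 - p) * ln (1 - p)) / (- p * ln b1 - (1 - p) * ln b2).

Definition self_similar (p b1 b2 : R) (mu : probability R R) : Prop :=
  forall A : set R, measurable A ->
    mu A = (p%:E * mu (T1 b1 @^-1` A) + (1 - p)%:E * mu (T2 b2 @^-1` A))%E.

(** sharp_k(s) for 0-based k : 'I_n : number of i <= k with s_i = 1
    (i.e. sharp_{k+1}(s) in the paper's 1-based indexing). *)
Definition sharp (n : nat) (s : 'I_n -> int) (k : nat) : nat :=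
  #|[pred i : 'I_n | (i <= k)%N && (s i == 1)]|.

Definition curve_poly (n : nat) (s t : 'I_n -> int) (x y : R) : R :=
  \sum_(k < n) ((s k)%:~R * x ^+ sharp s k * y ^+ (k.+1 - sharp s k)
              - (t k)%:~R * x ^+ sharp t k * y ^+ (k.+1 - sharp t k)).

(** Diameter of a subset of R (0 for the empty set). Only used for sets
    of diameter <= delta, hence bounded. *)
Definition diam (A : set R) : R := sup [set `|x - y| | x in A & y in A].

Definition hausdorff_content (s delta : R) (A : set R) : \bar R :=
  ereal_inf [set (\sum_(0 <= i <oo) ((diam (F i)) `^ s)%:E)%E
            | F in [set F : nat -> set R |
                     A `<=` \bigcup_i F i /\
                     forall i x y, F i x -> F i y -> `|x - y| <= delta]].

(** s-dimensional Hausdorff (outer) measure: limit as delta -> 0+,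
    i.e. the supremum over delta > 0 (the content is nonincreasing in delta). *)
Definition hausdorff_measure (s : R) (A : set R) : \bar R :=
  ereal_sup [set hausdorff_content s delta A | delta in [set d : R | 0 < d]].

Definition hausdorff_dim (A : set R) : \bar R :=
  ereal_inf [set s%:E | s in [set s : R | 0 < s /\ hausdorff_measure s A = 0%E]].

Definition hausdorff_dim_measure (mu : probability R R) : \bar R :=
  ereal_inf [set hausdorff_dim A | A in [set A : set R | measurable A /\ mu A = 1%E]].

Definition singular_lebesgue (mu : probability R R) : Prop :=
  exists A : set R, measurable A /\ mu A = 1%E /\ (@lebesgue_measure R) A = 0%E.

End Defs.

(* Main.v *)
Require Import Defs.
From HB Require Import structures.
From mathcomp Require Import all_boot all_order all_algebra.
From mathcomp Require Import all_classical all_reals all_analysis.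
From mathcomp Require Import measurable_realfun ring lra.
Set Implicit Arguments. Unset Strict Implicit. Unset Printing Implicit Defensive.
Import Order.TTheory GRing.Theory Num.Theory.
Import numFieldNormedType.Exports.
Local Open Scope classical_set_scope.
Local Open Scope ring_scope.

(** The curve condition, together with the equality of the numbers of 1's, says
that the compositions of [T1] and [T2] along [s] and along [t] are the same
affine map. Merging these two words of common probability [q] in the [n]-th
iterate of the system lowers its entropy by [2 q ln 2], so, with [H] the entropy
and [chi] the Lyapunov exponent of the original system, the entropy of the merged
system falls below its Lyapunov exponent as soon as [n (H - chi) < 2 q ln 2]. Since [H - chi] is negative for [p] near [0] and equals
[ln (b1 + b2) > 0] at [p = b1 / (b1 + b2)], the intermediate value theorem gives
[p] with [0 < n (H - chi) < 2 q ln 2]. For such [p], Chernoff's bound covers most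
of the mass by few small intervals, which yields a set of full measure and
Hausdorff dimension less than [1]. The stationary measure itself is the
Lebesgue-Stieltjes measure of a monotone limit of distribution functions. *)

(** * Existence of the self-similar measure *)

Section existence.
Variables (R : realType) (p b1 b2 : R).
Hypotheses (p01 : 0 < p < 1) (b1_01 : 0 < b1 < 1) (b2_01 : 0 < b2 < 1).

Let b1_gt0 : 0 < b1. Proof. by case/andP: b1_01. Qed.
Let b2_gt0 : 0 < b2. Proof. by case/andP: b2_01. Qed.
Let p_gt0 : 0 < p. Proof. by case/andP: p01. Qed.
Let q_gt0 : 0 < 1 - p. Proof. by case/andP: p01; lra. Qed.

(** [U1] and [U2] invert the increasing maps [T1 b1] and [T2 b2], so preimages of half-lines are
    half-lines and the measure equation becomes one between distribution functions. *)
Let U1 (x : R) := x / b1 - 1.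
Let U2 (x : R) := x / b2 + 1.

Let le_T1 x y : (T1 b1 x <= y) = (x <= U1 y).
Proof. by rewrite /T1 /U1 lerBrDr ler_pdivlMr// mulrDl mul1r mulrC. Qed.
Let le_T2 x y : (T2 b2 x <= y) = (x <= U2 y).
Proof. by rewrite /T2 /U2 -lerBlDr ler_pdivlMr// mulrBl mul1r mulrC. Qed.

(** Chosen so large that both maps send [[-L, L]] into itself, which confines all iterates to this
    interval. *)
Let L : R := (1 - b1)^-1 + (1 - b2)^-1.

Let L_bounds : [/\ 0 <= L, T1 b1 L <= L & - L <= T2 b2 (- L)].
Proof.
case/andP: b1_01 => h0 h1; case/andP: b2_01 => k0 k1.
have u0 : 0 < 1 - b1 by lra.
have v0 : 0 < 1 - b2 by lra.
have L1 : 1 <= L * (1 - b1).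
  by rewrite mulrDl mulVf ?gt_eqF// lerDl mulr_ge0 ?invr_ge0 ?ltW.
have L2 : 1 <= L * (1 - b2).
  by rewrite /L addrC mulrDl mulVf ?gt_eqF// lerDl mulr_ge0 ?invr_ge0 ?ltW.
have L0 : 0 <= L by rewrite /L addr_ge0 ?invr_ge0 ?ltW.
by split => //; rewrite /T1 /T2; nra.
Qed.

(* Iterates, started at the point mass at [-L], of the action of the
   self-similarity equation on distribution functions. *)
Let Fixpoint F (k : nat) (x : R) : R :=
  if k is k'.+1 then p * F k' (U1 x) + (1 - p) * F k' (U2 x)
  else (- L <= x)%R%:R.

Let U1_homo x y : x <= y -> U1 x <= U1 y.
Proof. by move=> xy; rewrite /U1 lerD2r ler_pM2r ?invr_gt0. Qed.
Let U2_homo x y : x <= y -> U2 x <= U2 y.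
Proof. by move=> xy; rewrite /U2 lerD2r ler_pM2r ?invr_gt0. Qed.

Let F_homo k x y : x <= y -> F k x <= F k y.
Proof.
elim: k x y => [|k IH] x y xy /=.
  by rewrite ler_nat; case: (leP (- L) x) => // h; rewrite (le_trans h xy).
by rewrite lerD// ler_pM2l// IH// (U1_homo, U2_homo).
Qed.

Let F_ge0 k x : 0 <= F k x.
Proof.
by elim: k x => [|k IH] x //=; rewrite addr_ge0// mulr_ge0// ltW.
Qed.

Let F_small k x : x < - L -> F k x = 0.
Proof.
have [L0 L1 L2] := L_bounds.
elim: k x => [|k IH] x xL /=; first by rewrite leNgt xL.
have h1 : U1 x < - L.
  by rewrite ltNge -le_T1 -ltNge (lt_le_trans xL)// /T1; case/andP: b1_01; nra.
have h2 : U2 x < - L by rewrite ltNge -le_T2 -ltNge (lt_le_trans xL).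
by rewrite !IH// !mulr0 addr0.
Qed.

Let F_large k x : L <= x -> F k x = 1.
Proof.
have [L0 L1 L2] := L_bounds.
elim: k x => [|k IH] x xL /=.
  by rewrite (le_trans _ xL)// lerNl (le_trans _ L0)// oppr_le0.
rewrite !IH ?mulr1 ?subrKC//.
  by rewrite -le_T2 (le_trans _ xL)// /T2; case/andP: b2_01; nra.
by rewrite -le_T1 (le_trans _ xL).
Qed.

Let F_le1 k x : F k x <= 1.
Proof.
have [xL|/ltW xL] := leP L x; first by rewrite F_large.
by rewrite -(F_large k (lexx L)) F_homo.
Qed.

(** The point mass starts at the left end of the invariant interval, so the first step can only move
    mass to the right; the recursion for [F] is monotone and preserves the inequality. *)
Let F_decr k x : F k.+1 x <= F k x.
Proof.
elim: k x => [|k IH] x; last first.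
  by apply: lerD; rewrite ler_pM2l//; exact: IH.
have [xL|xL] := leP (- L) x; last by rewrite !F_small.
by rewrite [leRHS]/= xL F_le1.
Qed.

(** Only the upper bound of right continuity: monotonicity supplies the lower one, and the upper one
    passes to the infimum [G]. *)
Let F_rc k x e : 0 < e -> exists2 d, 0 < d & forall y, y < x + d -> F k y <= F k x + e.
Proof.
elim: k x e => [|k IH] x e e0.
  have [xL|xL] := leP (- L) x.
    by exists 1 => // y _; rewrite [F 0 x]/= xL (le_trans (F_le1 _ _))// lerDl ltW.
  exists (- L - x); first by rewrite subr_gt0.
  by move=> y; rewrite subrKC => yL; rewrite !F_small// add0r ltW.
have [d1 d10 h1] := IH (U1 x) e e0; have [d2 d20 h2] := IH (U2 x) e e0.
(* [U1] and [U2] stretch distances by [1 / b1] and [1 / b2]. *)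
exists (Num.min (d1 * b1) (d2 * b2)); first by rewrite lt_min !mulr_gt0.
move=> y; rewrite -ltrBlDl lt_min => /andP[y1 y2] /=.
have {}y1 : U1 y < U1 x + d1.
  by rewrite /U1 addrAC ltrD2r -ltrBlDl -mulrBl ltr_pdivrMr.
have {}y2 : U2 y < U2 x + d2.
  by rewrite /U2 addrAC ltrD2r -ltrBlDl -mulrBl ltr_pdivrMr.
by have := h1 _ y1; have := h2 _ y2; move: p_gt0 q_gt0; nra.
Qed.

Let G (x : R) : R := inf (range (F^~ x)).

Let F_cvg x : F^~ x @ \oo --> G x.
Proof.
apply: nonincreasing_cvgn; first by apply/nonincreasing_seqP => k; exact: F_decr.
by exists 0 => _ [k _ <-]; exact: F_ge0.
Qed.

Let G_le k x : G x <= F k x.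
Proof.
apply: ge_inf; first by exists 0 => _ [j _ <-]; exact: F_ge0.
by exists k.
Qed.

Let G_nd : nondecreasing G.
Proof.
move=> x y xy; apply: lb_le_inf; first by exists (F 0 y), 0%N.
by move=> _ [k _ <-]; exact: le_trans (G_le k x) (F_homo _ xy).
Qed.

Let G_rc : right_continuous G.
Proof.
move=> x; apply/cvgrPdist_le => e e0.
have e20 : 0 < e / 2 by rewrite divr_gt0.
have [_ [k _ <-] kG] : exists2 z, range (F^~ x) z & z < G x + e / 2.
  apply: inf_adherent => //; split; first by exists (F 0 x), 0%N.
  by exists 0 => _ [j _ <-]; exact: F_ge0.
have [d d0 dF] := F_rc k x e20.
near=> y.
have xy : x <= y by near: y; exact: nbhs_right_ge.
rewrite distrC ger0_norm ?subr_ge0 ?G_nd//.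
have : F k y <= F k x + e / 2.
  by apply: dF; near: y; apply: nbhs_right_lt; rewrite ltrDl.
by have := G_le k y; lra.
Unshelve. all: by end_near. Qed.

HB.instance Definition _ := isCumulative.Build R _ R G G_nd G_rc.

Let G_Ny : G @ -oo --> (0 : R).
Proof.
apply: cvg_near_cst; near=> x.
have xL : x < - L by near: x; apply: nbhs_ninfty_lt; exact: num_real.
apply: (cvg_unique _ (F_cvg (x:=x))) => //.
by apply: cvg_near_cst; near=> k; rewrite F_small.
Unshelve. all: by end_near. Qed.

Let G_y : G @ +oo --> (1 : R).
Proof.
apply: cvg_near_cst; near=> x.
have xL : L <= x by near: x; apply: nbhs_pinfty_ge; exact: num_real.
apply: (cvg_unique _ (F_cvg (x:=x))) => //.
by apply: cvg_near_cst; near=> k; rewrite F_large.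
Unshelve. all: by end_near. Qed.

HB.instance Definition _ := isCumulativeBounded.Build R 0 1 G G_Ny G_y.

Let G_fix x : G x = p * G (U1 x) + (1 - p) * G (U2 x).
Proof.
have H : F^~ x @ \oo --> p * G (U1 x) + (1 - p) * G (U2 x).
  rewrite -(cvg_shiftS (F^~ x)) /=.
  by apply: cvgD; apply: cvgM; (exact: cvg_cst || exact: F_cvg).
exact: (cvg_unique _ (F_cvg (x:=x)) H).
Qed.

Let lsG := lebesgue_stieltjes_measure G.

Let lsG_itv a b : a <= b -> lsG `]a, b]%classic = (G b - G a)%:E.
Proof.
move=> ab; rewrite /lsG /lebesgue_stieltjes_measure /measure_extension/=.
by rewrite measurable_mu_extE/= ?wlength_itv_bnd//; exact: is_ocitv.
Qed.

Let mT1 : measurable_fun [set: measurableTypeR R] (T1 b1 : _ -> measurableTypeR R).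
Proof.
have : measurable_fun [set: R] (T1 b1); last exact.
by apply: measurable_funD => //; apply: measurable_funM.
Qed.

Let mT2 : measurable_fun [set: measurableTypeR R] (T2 b2 : _ -> measurableTypeR R).
Proof.
have : measurable_fun [set: R] (T2 b2); last exact.
by apply: measurable_funB => //; apply: measurable_funM.
Qed.

Let T1' : measurableTypeR R -> measurableTypeR R := T1 b1.
Let T2' : measurableTypeR R -> measurableTypeR R := T2 b2.
HB.instance Definition _ := @isMeasurableFun.Build _ _ _ _ T1' mT1.
HB.instance Definition _ := @isMeasurableFun.Build _ _ _ _ T2' mT2.

Let preT1 a b : T1 b1 @^-1` `]a, b] = `]U1 a, U1 b]%classic.
Proof.
by apply/seteqP; split => x; rewrite /= !in_itv/= le_T1 [a < _]ltNge le_T1 -ltNge.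
Qed.

Let preT2 a b : T2 b2 @^-1` `]a, b] = `]U2 a, U2 b]%classic.
Proof.
by apply/seteqP; split => x; rewrite /= !in_itv/= le_T2 [a < _]ltNge le_T2 -ltNge.
Qed.

Let nu := measure_add (mscale (NngNum (ltW p_gt0)) (distribution lsG T1'))
  (mscale (NngNum (ltW q_gt0)) (distribution lsG T2')).

Let nuE A : nu A = (p%:E * lsG (T1 b1 @^-1` A) + (1 - p)%:E * lsG (T2 b2 @^-1` A))%E.
Proof. by rewrite /nu measure_addE. Qed.

(** On intervals []a, b]] both sides reduce to the fixed-point equation [G_fix], and these intervals
    determine the measure. *)
Let lsG_self_similar A : measurable A -> lsG A = nu A.
Proof.
move=> mA; apply: lebesgue_stieltjes_measure_unique => // _ [[a b] /= _ <-].
have [ab|ba] := leP a b; last first.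
  by rewrite set_itv_ge ?measure0// bnd_simp -leNgt ltW.
rewrite [RHS]nuE [LHS]lsG_itv// preT1 preT2.
rewrite !lsG_itv ?U1_homo ?U2_homo// -!EFinM -EFinD.
by rewrite (G_fix a) (G_fix b); congr EFin; ring.
Qed.

(** The Stieltjes measure lives on [measurableTypeR R]; its image under this identity is a measure
    on [R] itself. *)
Let idTR : measurableTypeR R -> R := idfun.

HB.instance Definition _ :=
  @isMeasurableFun.Build _ _ _ _ idTR (@measurable_id _ _ setT).

Lemma self_similar_exists : exists mu : probability R R, self_similar p b1 b2 mu.
Proof.
exists (distribution lsG idTR) => A mA.
by rewrite -nuE; exact: lsG_self_similar.
Qed.

End existence.

(** * Null sets from efficient covers *)

Section small_covers.
Variable R : realType.
Implicit Types (s e : R) (l : seq (R * R)) (mu : probability R R).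

Definition cover_set l : set R := \big[setU/set0]_(x <- l) `[x.1, x.2]%classic.

Lemma measurable_cover_set l : measurable (cover_set l).
Proof. by apply: bigsetU_measurable => x _; exact: measurable_itv. Qed.

Lemma cover_setP l z : cover_set l z -> exists2 k, (k < size l)%N &
  (nth (0, 0) l k).1 <= z <= (nth (0, 0) l k).2.
Proof.
rewrite /cover_set (big_nth (0, 0)) big_mkord.
rewrite -(bigcup_mkord _ (fun k => `[(nth (0, 0) l k).1, (nth (0, 0) l k).2]%classic)).
by move=> [k /= kl]; rewrite in_itv/=; exists k.
Qed.

Lemma diam_itv (a b : R) : a <= b -> diam `[a, b]%classic = b - a.
Proof.
move=> ab; apply/eqP; rewrite eq_le; apply/andP; split.
  apply: ge_sup; first by exists `|a - a|; exists a => /=; rewrite ?in_itv/= ?lexx//;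
    exists a => //=; rewrite in_itv/= lexx.
  move=> _ [x /= + [y /= + <-]]; rewrite !in_itv/= => /andP[? ?] /andP[? ?].
  by rewrite ler_norml; apply/andP; split; lra.
apply: ub_le_sup.
  exists (b - a) => _ [x /= + [y /= + <-]]; rewrite !in_itv/= => /andP[? ?] /andP[? ?].
  by rewrite ler_norml; apply/andP; split; lra.
exists b => /=; first by rewrite in_itv/= ab lexx.
by exists a => /=; rewrite ?in_itv/= ?lexx ?ab// ger0_norm// subr_ge0.
Qed.

Lemma diam_set0 : diam (set0 : set R) = 0.
Proof.
rewrite /diam (_ : [set _ | _ in _ & _ in _] = set0) ?sup0//.
by apply/seteqP; split => // _ [x []].
Qed.

Lemma hausdorff_content_ge0 s e (A : set R) : (0 <= hausdorff_content s e A)%E.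
Proof.
apply: le_ereal_inf_tmp => _ [F _ <-]; apply: nneseries_ge0 => i _ _.
by rewrite lee_fin powR_ge0.
Qed.

(** Serves to flatten covers indexed by pairs into the single sequence that [hausdorff_content] asks
    for. *)
Lemma nneseries_nat2 (a : nat * nat -> \bar R) (f : {splitbij [set: nat] >-> [set: nat * nat]}) :
  (forall i, 0 <= a i)%E ->
  (\sum_(0 <= k <oo) a (f k) = \sum_(0 <= i <oo) \sum_(0 <= j <oo) a (i, j))%E.
Proof.
move=> a0; rewrite nneseries_esumT//.
rewrite -(reindex_esum setT setT f a) => //=.
rewrite nneseries_esumT; last by move=> i; apply: nneseries_ge0.
under eq_esum => i _ do rewrite nneseries_esumT//.
rewrite esum_esum//; congr esum; last by apply/funext => -[].
by apply/seteqP; split.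
Qed.

(* The null set is the limsup of the covers of size [1 / 2 ^ j]. *)
Lemma hausdorff_null_of_covers s mu : 0 < s -> s <= 1 ->
  (forall e, 0 < e -> exists l,
     [/\ forall x, x \in l -> 0 < x.2 - x.1 <= e,
         \sum_(x <- l) (x.2 - x.1) `^ s <= e &
         ((1 - e)%:E <= mu (cover_set l))%E]) ->
  exists A : set R, [/\ measurable A, mu A = 1%E,
    (@lebesgue_measure R) A = 0%E & hausdorff_measure s A = 0%E].
Proof.
move=> s0 s1 covers.
have pow_gt0 j : 0 < 1 / (2 ^ j)%:R :> R by rewrite divr_gt0// ltr0n expn_gt0.
have /choice[l lP] j := covers _ (pow_gt0 j.+1).
have pow_small e : 0 < e -> exists M, 1 / (2 ^ M)%:R <= e.
  move=> e0; exists (Num.bound e^-1).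
  rewrite div1r invf_ple ?posrE ?ltr0n ?expn_gt0//.
  by rewrite natrX ltW// upper_nthrootP.
(* The shape required by [epsilon_trick0]: the bounds for the covers from index [M] on add up to
   [1 / 2 ^ M]. *)
have powD M i : 1 / (2 ^ (M + i).+1)%:R = (1 / (2 ^ M)%:R) / (2 ^ i.+1)%:R :> R.
  by rewrite -addnS expnD natrM invfM mulrA.
have pow_tail M i : 1 / (2 ^ (M + i).+1)%:R <= 1 / (2 ^ M)%:R :> R.
  rewrite !div1r lef_pV2 ?posrE ?ltr0n ?expn_gt0// ler_nat leq_exp2l//.
  by rewrite -addnS leq_addr.
pose G j := cover_set (l j).
have mG j : measurable (G j) by exact: measurable_cover_set.
have sub M : lim_sup_set G `<=` \bigcup_i G (M + i)%N.
  move=> x /(_ M I)[j /= Mj Gx]; exists (j - M)%N => //.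
  by rewrite subnKC.
have mlim : measurable (lim_sup_set G).
  by apply: bigcap_measurableType => n _; apply: bigcup_measurable => k _.
exists (lim_sup_set G); split => //.
(* Every tail union contains covers of measure arbitrarily close to 1, hence has measure 1;
   continuity from above carries this to the limsup. *)
- have tail n : mu (\bigcup_(k in [set k | (n <= k)%N]) G k) = 1%E.
    have mU : measurable (\bigcup_(k in [set k | (n <= k)%N]) G k).
      by apply: bigcup_measurable => k _.
    apply/eqP; rewrite eq_le probability_le1//=; apply/lee_addgt0Pr => e e0.
    have [M Me] := pow_small _ e0.
    apply: (@le_trans _ _ (mu (G (M + n)%N) + e%:E)%E); last first.
      rewrite leeD2r//; apply: le_measure; rewrite ?inE//.
      by apply: bigcup_sup => /=; rewrite leq_addl.
    have [_ _ h] := lP (M + n)%N.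
    apply: (@le_trans _ _ ((1 - 1 / (2 ^ (M + n).+1)%:R)%:E + e%:E)%E); last first.
      by rewrite leeD2r.
    rewrite -EFinD lee_fin; have := pow_tail M n; lra.
  have h : mu (\bigcup_(k in [set k | (n <= k)%N]) G k) @[n --> \oo] -->
      mu (lim_sup_set G).
    apply: lim_sup_set_cvg => //; apply: le_lt_trans (probability_le1 _ _) _.
      exact: bigcup_measurable.
    exact: ltry.
  rewrite (funext tail) in h.
  exact: (cvg_unique _ h (cvg_cst _)).
(* As in Borel-Cantelli: lengths are at most 1 and [s <= 1], so each length is at most its [s]-th
   power, and the powers have small sums over tails. *)
- apply/eqP; rewrite eq_le measure_ge0 andbT; apply/lee_addgt0Pr => e e0.
  have [M Me] := pow_small _ e0; rewrite add0e.
  apply: le_trans (_ : _ <= \sum_(0 <= i <oo) (@lebesgue_measure R) (G (M + i)%N))%E _.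
    exact: (@measure_sigma_subadditive _ R _ (@lebesgue_measure R) _
      (fun i => G (M + i)%N) (fun i => mG _) mlim (sub M)).
  apply: le_trans (_ : _ <= (1 / (2 ^ M)%:R)%:E)%E _; last by rewrite lee_fin.
  apply: le_trans (epsilon_trick0 xpredT (ltW (pow_gt0 M))).
  apply: lee_nneseries => [i _ _|i _]; first exact: measure_ge0.
  rewrite -powD; have [h1 h2 _] := lP (M + i)%N.
  apply: le_trans (_ : _ <= (\sum_(x <- l (M + i)%N) (x.2 - x.1) `^ s)%:E)%E _;
    last by rewrite lee_fin.
  have {}h1 x : x \in l (M + i)%N -> 0 < x.2 - x.1 <= 1.
    move=> /h1 /andP[-> /le_trans -> //]; rewrite div1r invf_le1 ?ltr0n ?expn_gt0//.
    by rewrite ler1n expn_gt0.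
  rewrite /G; elim: (l (M + i)%N) h1 => [|x r IH] h1.
    by rewrite /cover_set !big_nil measure0.
  rewrite /cover_set !big_cons EFinD.
  apply: (le_trans (measureU2 _ _ _)); first exact: measurable_itv.
    exact: measurable_cover_set.
  apply: leeD; last by apply: IH => y yr; rewrite h1// inE yr orbT.
  have /andP[x0 x1] := h1 x (mem_head _ _).
  rewrite [leLHS]lebesgue_measure_itv/= lte_fin -subr_gt0 x0 -EFinB lee_fin.
  by rewrite ger1_powR// x0.
- apply/eqP; rewrite eq_le; apply/andP; split; last first.
    apply: (le_trans (hausdorff_content_ge0 s 1 (lim_sup_set G))).
    by apply: ereal_sup_ubound; exists 1 => //=.
  apply: ge_ereal_sup => _ [d /= d0 <-]; apply/lee_addgt0Pr => e e0; rewrite add0e.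
  have [M] : exists M, 1 / (2 ^ M)%:R <= Num.min d e by apply: pow_small; rewrite lt_min d0.
  rewrite le_min => /andP[Md Me].
  have /card_esym/ppcard_eqP[f] := card_nat2.
  (* The pair [(i, j)] names interval [j] of cover [M + i]. Past the end of the list the set is
     empty; its diameter is 0, whose [s]-th power vanishes because [s > 0]. *)
  pose F (i : nat * nat) : set R := let l' := l (M + i.1)%N in
    if (i.2 < size l')%N then `[(nth (0, 0) l' i.2).1, (nth (0, 0) l' i.2).2]%classic
    else set0.
  apply: le_trans (_ : _ <= \sum_(0 <= k <oo) (diam (F (f k)) `^ s)%:E)%E _.
    apply: ereal_inf_lbound; exists (F \o f) => //; split.
      move=> x /(sub M)[i _ /cover_setP[k kl xk]]; exists (f^-1%FUN (i, k)) => //=.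
      by rewrite invK ?inE// /F /= kl.
    move=> k x y /=; rewrite /F; case: ifPn => // kl; rewrite /= !in_itv/=.
    move=> /andP[? ?] /andP[? ?].
    have [h1 _ _] := lP (M + (f k).1)%N; have := h1 _ (mem_nth (0, 0) kl).
    by have := pow_tail M (f k).1; rewrite ler_norml => ? /andP[? ?]; apply/andP; split; lra.
  rewrite (nneseries_nat2 (a := fun i => (diam (F i) `^ s)%:E)); last first.
    by move=> i; rewrite lee_fin powR_ge0.
  apply: le_trans (_ : _ <= (1 / (2 ^ M)%:R)%:E)%E _; last by rewrite lee_fin.
  apply: le_trans (epsilon_trick0 xpredT (ltW (pow_gt0 M))).
  apply: lee_nneseries => [i _ _|i _].
    by apply: nneseries_ge0 => j _ _; rewrite lee_fin powR_ge0.
  rewrite -powD; have [h1 h2 _] := lP (M + i)%N.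
  rewrite (nneseries_split 0 (size (l (M + i)%N))); last first.
    by move=> j _; rewrite lee_fin powR_ge0.
  rewrite eseries0 ?adde0; last first.
    move=> j; rewrite add0n => lj _; rewrite /F /= ltnNge lj /= diam_set0 powR0//.
    by rewrite gt_eqF.
  rewrite sumEFin lee_fin add0n; apply: le_trans h2.
  rewrite (big_nth (0, 0)) !big_mkord; apply: ler_sum => j _.
  rewrite /F /= ltn_ord diam_itv//.
  by rewrite -subr_ge0; have /andP[/ltW] := h1 _ (mem_nth (0, 0) (ltn_ord j)).
Qed.

End small_covers.

(** * Stationary measures of finite systems of similarities *)

Section systems.
Variable R : realType.

(* [(w, r, c)] stands for the map [z |-> r * z + c] taken with probability [w]. *)
Definition simil : Type := (R * R * R)%type.
Implicit Types (x y : simil) (l m : seq simil) (mu : probability R R).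

Definition wt x : R := x.1.1.
Definition rt x : R := x.1.2.
Definition app x (z : R) : R := rt x * z + x.2.

(** A list rather than a set of maps: coinciding maps may occur twice until they are merged. *)
Definition stationary mu l := forall A : set R, measurable A ->
  fine (mu A) = \sum_(x <- l) wt x * fine (mu (app x @^-1` A)).

Lemma measurable_app_preimage x (A : set R) : measurable A -> measurable (app x @^-1` A).
Proof.
move=> mA; rewrite -[X in measurable X]setTI.
have : measurable_fun [set: R] (app x); last exact.
by apply: measurable_funD => //; apply: measurable_funM.
Qed.

Lemma stationary_total mu l : stationary mu l -> \sum_(x <- l) wt x = 1.
Proof.
move=> h; transitivity (fine (mu setT)); last by rewrite probability_setT.
by rewrite h//; apply: eq_bigr => x _; rewrite preimage_setT probability_setT mulr1.
Qed.

Definition comp_simil x y : simil := (wt x * wt y, rt x * rt y, rt x * y.2 + x.2).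

Lemma wt_comp x y : wt (comp_simil x y) = wt x * wt y.
Proof. by []. Qed.

Lemma rt_comp x y : rt (comp_simil x y) = rt x * rt y.
Proof. by []. Qed.

Lemma stationary_comp mu l m : stationary mu l -> stationary mu m ->
  stationary mu [seq comp_simil x y | x <- l, y <- m].
Proof.
move=> hl hm A mA; rewrite hl// big_allpairs_dep/=; apply: eq_bigr => x _.
rewrite (hm _ (measurable_app_preimage x mA)) mulr_sumr.
apply: eq_bigr => y _; rewrite mulrA (_ : app (comp_simil x y) = app x \o app y)//.
by apply/funext => z; rewrite /app /comp_simil /rt /=; ring.
Qed.

(** The logarithm of [w / r ^ d]. Its mean is [d] times the Lyapunov exponent minus the entropy. *)
Definition excess (d : R) x : R := ln (wt x) - d * ln (rt x).

(** The Laplace transform of the excess of a random map of the system. *)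
Definition laplace (d th : R) l : R := \sum_(x <- l) wt x * expR (- th * excess d x).

(** Under composition weights multiply and excesses add, so [laplace] is multiplicative. *)
Lemma stationary_iter mu l d th rho N : stationary mu l ->
  (forall x, x \in l -> [/\ 0 < wt x, 0 < rt x & rt x <= rho]) ->
  exists m, [/\ stationary mu m,
    forall x, x \in m -> [/\ 0 < wt x, 0 < rt x & rt x <= rho ^+ N] &
    laplace d th m = laplace d th l ^+ N].
Proof.
move=> hl lP; elim: N => [|N [m [hm mP mL]]].
  exists [:: (1, 1, 0)]; split.
  - move=> A mA; rewrite big_seq1 /wt/= mul1r; congr (fine (mu _)).
    by apply/seteqP; split => z; rewrite /app /rt /= mul1r addr0.
  - by move=> x; rewrite inE => /eqP ->; rewrite /wt /rt /=.
  - by rewrite /laplace big_seq1 /excess /wt /rt /= ln1 mulr0 subr0 mulr0 expR0 mulr1.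
exists [seq comp_simil x y | x <- l, y <- m]; split.
- exact: stationary_comp.
- move=> _ /allpairsP[[x y] /= [/lP[x1 x2 x3] /mP[y1 y2 y3] ->]].
  rewrite /wt /rt /= !mulr_gt0//; split => //.
  by rewrite exprS ler_pM// ltW.
- rewrite /laplace big_allpairs_dep/= exprS -mL /laplace mulr_suml.
  rewrite big_seq [RHS]big_seq; apply: eq_bigr => x /lP[x1 x2 _].
  rewrite mulr_sumr big_seq [RHS]big_seq; apply: eq_bigr => y /mP[y1 y2 _].
  have -> : excess d (comp_simil x y) = excess d x + excess d y.
    by rewrite /excess {1}/wt {1}/rt /= !lnM ?posrE//; ring.
  by rewrite mulrDr expRD /comp_simil {1}/wt /=; ring.
Qed.

(** From [expR x * (1 - x) <= 1] and [(1 + x + 2 x^2) (1 - x) = 1 + x^2 (1 - 2 x) >= 1]. *)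
Lemma expR_le_quadratic (x : R) : x <= 1 / 2 -> expR x <= 1 + x + 2 * x ^+ 2.
Proof.
move=> x2; have h := expR_ge1Dx (- x).
have e1 : expR x * expR (- x) = 1 by rewrite -expRD subrr expR0.
have e0 := expR_gt0 x.
have : expR x * (1 - x) <= 1 by rewrite -{2}e1 ler_pM2l.
have x1 : 0 < 1 - x by lra.
move=> h1; rewrite -(ler_pM2r x1) (le_trans h1)//; nra.
Qed.

(** The transform equals 1 at [th = 0] and has derivative [- E < 0] there; the quadratic bound on
    [expR] makes this quantitative. *)
Lemma laplace_lt1 mu l d : stationary mu l -> (forall x, x \in l -> 0 < wt x) ->
  0 < \sum_(x <- l) wt x * excess d x ->
  exists2 th, 0 < th & laplace d th l < 1.
Proof.
move=> hl l0; set E := \sum_(x <- l) _ => E0.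
pose B := 1 + \sum_(x <- l) `|excess d x|.
pose C := \sum_(x <- l) wt x * (2 * excess d x ^+ 2).
have B0 : 0 < B by rewrite ltr_pwDl// sumr_ge0.
have C0 : 0 <= C.
  rewrite /C big_seq sumr_ge0// => x /l0 w0.
  by rewrite mulr_ge0 ?(ltW w0)// mulr_ge0// sqr_ge0.
have ZB x : x \in l -> - excess d x <= B.
  move=> xl; rewrite /B (big_rem x xl)/=.
  have : 0 <= \sum_(y <- rem x l) `|excess d y| by rewrite sumr_ge0.
  by have := ler_norm (- excess d x); rewrite normrN; lra.
(* The first bound keeps every exponent below [1 / 2], so the quadratic estimate applies; the second
   makes [th ^+ 2 * C] smaller than [th * E]. The [+ 1] keeps the denominator positive. *)
pose th := Num.min (1 / (2 * B)) (E / (2 * (C + 1))).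
have C10 : 0 < 2 * (C + 1) by lra.
have th0 : 0 < th by rewrite lt_min !divr_gt0//; lra.
have thB : th * B <= 1 / 2.
  have : th <= 1 / (2 * B) by rewrite ge_min lexx.
  by rewrite ler_pdivlMr; lra.
have thC : th * (2 * (C + 1)) <= E.
  by rewrite -ler_pdivlMr// ge_min lexx orbT.
exists th => //.
apply: le_lt_trans (_ : _ <= 1 - th * E + th ^+ 2 * C) _; last first.
  suff : th * (th * C) < th * E by rewrite expr2; lra.
  rewrite ltr_pM2l//; apply: lt_le_trans thC; nra.
rewrite -(stationary_total hl) /laplace /E /C !mulr_sumr -sumrB -big_split/=.
rewrite big_seq [leRHS]big_seq; apply: ler_sum => x xl.
have w0 := l0 _ xl.
have /expR_le_quadratic h : - th * excess d x <= 1 / 2.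
  by rewrite mulNr -mulrN (le_trans _ thB)// ler_pM2l// ZB.
apply: (@le_trans _ _ (wt x * (1 + - th * excess d x + 2 * (- th * excess d x) ^+ 2))).
  by rewrite ler_pM2l.
by rewrite le_eqVlt; apply/orP; left; apply/eqP; ring.
Qed.

Definition good_cover (d K : R) l : seq (R * R) :=
  [seq (app x (- K), app x K) | x <- l & 0 <= excess d x].

Lemma cover_set_good_cover d K l x z : x \in l -> 0 <= excess d x -> 0 < rt x ->
  - K <= z <= K -> cover_set (good_cover d K l) (app x z).
Proof.
move=> xl x0 r0 /andP[z1 z2].
rewrite /cover_set /good_cover big_map big_filter (big_rem x xl)/= x0; left.
by rewrite /= in_itv/= /app !lerD2r !ler_pM2l// z1.
Qed.

(** Stationarity is compared term by term. For a map of nonnegative excess the preimage of the cover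
    contains [[-K, K]]; for any other map the exponential is at least 1, so the left-hand term is at
    most 0. *)
Lemma measure_good_cover mu d th K l : 0 < th -> stationary mu l ->
  (forall x, x \in l -> 0 < wt x /\ 0 < rt x) ->
  fine (mu `[- K, K]%classic) - laplace d th l <= fine (mu (cover_set (good_cover d K l))).
Proof.
move=> th0 hl lP; set C := cover_set _; set k := fine _.
have mC : measurable C by exact: measurable_cover_set.
have k01 : 0 <= k <= 1.
  rewrite fine_ge0//= -lee_fin fineK ?fin_num_measure//.
  exact: probability_le1.
rewrite [leRHS]hl//.
apply: (@le_trans _ _ (\sum_(x <- l) wt x * (k - expR (- th * excess d x)))).
  under [leRHS]eq_bigr do rewrite mulrBr.
  by rewrite sumrB -mulr_suml (stationary_total hl) mul1r.
rewrite big_seq [leRHS]big_seq; apply: ler_sum => x xl.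
have [w0 r0] := lP _ xl; rewrite ler_pM2l//.
have [x0|x0] := leP 0 (excess d x).
  apply: (@le_trans _ _ k); first by rewrite gerBl expR_ge0.
  apply: fine_le; rewrite ?fin_num_measure//; first exact: measurable_app_preimage.
  apply: le_measure; rewrite ?inE//; first exact: measurable_app_preimage.
  by move=> z /=; rewrite in_itv/=; exact: cover_set_good_cover.
apply: (@le_trans _ _ 0); last exact: fine_ge0.
rewrite subr_le0; case/andP: k01 => _ /le_trans; apply.
by rewrite -expR0 ler_expR nmulr_rge0 ?ltW// oppr_lt0.
Qed.

Lemma good_cover_sum mu d s K rho l : 0 < K -> d < s -> 0 < s -> stationary mu l ->
  (forall x, x \in l -> [/\ 0 < wt x, 0 < rt x & rt x <= rho]) ->
  \sum_(x <- good_cover d K l) (x.2 - x.1) `^ s <= (2 * K) `^ s * rho `^ (s - d).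
Proof.
move=> K0 ds s0 hl lP; rewrite /good_cover big_map big_filter.
apply: (@le_trans _ _ (\sum_(x <- l) wt x * ((2 * K) `^ s * rho `^ (s - d)))); last first.
  by rewrite -mulr_suml (stationary_total hl) mul1r.
rewrite big_mkcond/= big_seq [leRHS]big_seq; apply: ler_sum => x /lP[w0 r0 rr].
case: ifPn => x0; last by rewrite !mulr_ge0 ?powR_ge0// ltW.
have -> : app x K - app x (- K) = 2 * K * rt x by rewrite /app; ring.
rewrite powRM ?(ltW r0) ?mulr_ge0 ?(ltW K0)//.
rewrite mulrCA ler_wpM2l ?powR_ge0//.
have -> : rt x `^ s = rt x `^ d * rt x `^ (s - d).
  by rewrite -powRD ?subrKC// gt_eqF.
(* Nonnegative excess says exactly that the ratio to the power [d] is at most the weight. *)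
apply: ler_pM; rewrite ?powR_ge0//.
  by rewrite /powR gt_eqF// -ler_ln ?posrE ?expR_gt0// expRK -subr_ge0.
by apply: ge0_ler_powR; rewrite ?nnegrE ?(ltW r0) ?subr_ge0 ?(ltW ds)// (le_trans (ltW r0)).
Qed.

Lemma expr_eventually_small (z e : R) : 0 <= z < 1 -> 0 < e ->
  \forall N \near \oo, z ^+ N <= e.
Proof.
move=> /andP[z0 z1] e0.
have /cvgr_le : z ^+ n @[n --> \oo] --> 0 by apply: cvg_expr; rewrite ger0_norm.
exact.
Qed.

Lemma ratio_bound l : (forall x, x \in l -> rt x < 1) ->
  exists2 rho, 0 < rho < 1 & forall x, x \in l -> rt x <= rho.
Proof.
elim: l => [|x l IH] lP; first by exists (1 / 2) => //; apply/andP; split; lra.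
have [y yl|rho /andP[r0 r1] h] := IH; first by apply: lP; rewrite inE yl orbT.
exists (Num.max rho (rt x)).
  by rewrite lt_max r0/= gt_max r1 lP ?mem_head.
by move=> y; rewrite inE le_max => /predU1P[->|/h ->//]; rewrite lexx orbT.
Qed.

Lemma measure_itv_cvg1 mu (e : R) : 0 < e ->
  exists2 K : R, 0 < K & 1 - e <= fine (mu `[- K, K]%classic).
Proof.
move=> e0; pose I n : set R := `[- n%:R, n%:R]%classic.
have : (mu \o I) n @[n --> \oo] --> mu (\bigcup_n I n).
  apply: nondecreasing_cvg_mu => //; first by move=> n; exact: measurable_itv.
    by apply: bigcup_measurable => n _; exact: measurable_itv.
  by move=> n k nk; apply/subsetPset/subset_itv; rewrite leBSide/= ?lerN2 ler_nat.
rewrite (bigcup_itvT true false) probability_setT => /fine_cvg/cvgr_ge.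
move=> /(_ (1 - e)); rewrite ltrBlDr ltrDl => /(_ e0) h.
near \oo => n; exists n%:R; last by near: n.
by rewrite ltr0n; near: n; exact: nbhs_infty_gt.
Unshelve. all: by end_near. Qed.

(* Chernoff's bound makes the words with [w < r ^ d] exponentially unlikely,
   and the images under the other words have small total [s]-content since
   [r ^ s <= w * r ^ (s - d)]. *)
Lemma stationary_covers mu l d s : 0 < s -> d < s -> stationary mu l ->
  (forall x, x \in l -> [/\ 0 < wt x, 0 < rt x & rt x < 1]) ->
  0 < \sum_(x <- l) wt x * excess d x ->
  forall e : R, 0 < e -> exists c : seq (R * R),
     [/\ forall x : R * R, x \in c -> 0 < x.2 - x.1 <= e,
         \sum_(x <- c) (x.2 - x.1) `^ s <= e &
         ((1 - e)%:E <= mu (cover_set c))%E].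
Proof.
move=> s0 ds hl lP E0 e e0.
have [rho /andP[r0 r1] hr] : exists2 rho, 0 < rho < 1 & forall x, x \in l -> rt x <= rho.
  by apply: ratio_bound => x /lP[].
have [th th0 L1] : exists2 th, 0 < th & laplace d th l < 1.
  by apply: (laplace_lt1 hl) => // x /lP[].
have L0 : 0 <= laplace d th l.
  by rewrite /laplace big_seq sumr_ge0// => x /lP[w0 _ _]; rewrite mulr_ge0 ?expR_ge0 ?ltW.
have e20 : 0 < e / 2 by rewrite divr_gt0.
have [K K0 hK] := measure_itv_cvg1 mu e20.
have K20 : 0 < 2 * K by rewrite mulr_gt0.
have Ks0 : 0 < (2 * K) `^ s by rewrite powR_gt0.
have rs1 : 0 <= rho `^ (s - d) < 1.
  rewrite powR_ge0/= -[ltRHS](_ : 1 `^ (s - d) = 1); last by rewrite powR1.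
  by apply: gt0_ltr_powR; rewrite ?nnegrE ?ler01 ?(ltW r0)// subr_gt0.
(* A high iterate makes three quantities small at once: the mass of the discarded words, the
   interval lengths and the [s]-content. *)
near \oo => N.
have N1 : laplace d th l ^+ N <= e / 2.
  by near: N; apply: expr_eventually_small => //; rewrite L0.
have N2 : rho ^+ N <= e / (2 * K).
  by near: N; apply: expr_eventually_small; rewrite ?divr_gt0// ltW.
have N3 : (rho `^ (s - d)) ^+ N <= e / (2 * K) `^ s.
  by near: N; apply: expr_eventually_small; rewrite ?divr_gt0.
have [m [hm mP mL]] : exists m, [/\ stationary mu m,
    forall x, x \in m -> [/\ 0 < wt x, 0 < rt x & rt x <= rho ^+ N] &
    laplace d th m = laplace d th l ^+ N].
  by apply: stationary_iter => // x xl; have [? ? _] := lP _ xl; split => //; exact: hr.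
exists (good_cover d K m); split.
- move=> _ /mapP[x + ->] /=; rewrite mem_filter => /andP[_ /mP[_ x0 xr]].
  have -> : app x K - app x (- K) = 2 * K * rt x by rewrite /app; ring.
  rewrite mulr_gt0//=; move: N2; rewrite ler_pdivlMr// mulrC; apply: le_trans.
  by rewrite ler_pM2l.
- apply: (le_trans (good_cover_sum K0 ds s0 hm mP)).
  move: N3; rewrite ler_pdivlMr// mulrC; apply: le_trans.
  rewrite ler_pM2l// -!powR_mulrn ?powR_ge0 ?(ltW r0)//.
  by rewrite powRAC.
- rewrite -[leRHS]fineK ?fin_num_measure//; last exact: measurable_cover_set.
  rewrite lee_fin; apply: le_trans (measure_good_cover d K th0 hm _); last first.
    by move=> x /mP[].
  by rewrite mL; lra.
Unshelve. all: by end_near. Qed.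

(** The hypothesis is positivity of the mean excess at [d = 1]. It persists for some [d < 1], and
    the covers then work for any [s] strictly between [d] and 1. *)
Lemma stationary_dim_lt1 mu l : stationary mu l ->
  (forall x, x \in l -> [/\ 0 < wt x, 0 < rt x & rt x < 1]) ->
  0 < \sum_(x <- l) wt x * (ln (wt x) - ln (rt x)) ->
  singular_lebesgue mu /\ (hausdorff_dim_measure mu < 1%:E)%E.
Proof.
move=> hl lP E0.
pose c := \sum_(x <- l) wt x * ln (rt x).
have [d /andP[d0 d1] Ed] : exists2 d, 0 < d < 1 & 0 < \sum_(x <- l) wt x * excess d x.
  set E := \sum_(x <- l) _ in E0.
  (* Lowering [d] from 1 to [1 - q] changes the mean excess from [E] to [E + q * c]; this [q]
     ensures [q * |c| < E], and [q <= 1 / 2] keeps [d] positive. *)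
  pose q := Num.min (1 / 2) (E / (2 * (`|c| + 1))).
  have c0 : 0 < 2 * (`|c| + 1) by rewrite mulr_gt0// ltr_wpDl.
  have q0 : 0 < q by rewrite lt_min !divr_gt0.
  have q1 : q <= 1 / 2 by rewrite ge_min lexx.
  have q2 : q * (2 * (`|c| + 1)) <= E.
    by rewrite -ler_pdivlMr// ge_min lexx orbT.
  exists (1 - q); first by apply/andP; split; lra.
  have -> : \sum_(x <- l) wt x * excess (1 - q) x = E + q * c.
    rewrite /E /c mulr_sumr -big_split/=; apply: eq_bigr => x _.
    by rewrite /excess; ring.
  have : - `|c| <= c by rewrite lerNnormlW.
  by have := normr_ge0 c; nra.
pose s := (1 + d) / 2.
have s0 : 0 < s by rewrite /s; lra.
have s1 : s < 1 by rewrite /s; lra.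
have ds : d < s by rewrite /s; lra.
have [A [mA muA lA hA]] := hausdorff_null_of_covers s0 (ltW s1)
  (stationary_covers s0 ds hl lP Ed).
split; first by exists A.
apply: (@le_lt_trans _ _ s%:E); last by rewrite lte_fin.
apply: (@le_trans _ _ (hausdorff_dim A)).
  by apply: ereal_inf_lbound; exists A.
by apply: ereal_inf_lbound; exists s.
Qed.

End systems.

(** * Words and exact overlaps *)

Section words.
Variables (R : realType) (p b1 b2 : R).
Hypotheses (p01 : 0 < p < 1) (b1_01 : 0 < b1 < 1) (b2_01 : 0 < b2 < 1).
Implicit Types (w : seq bool) (l m : seq (simil R)) (mu : probability R R).

Let b1_gt0 : 0 < b1. Proof. by case/andP: b1_01. Qed.
Let b2_gt0 : 0 < b2. Proof. by case/andP: b2_01. Qed.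
Let b1_lt1 : b1 < 1. Proof. by case/andP: b1_01. Qed.
Let b2_lt1 : b2 < 1. Proof. by case/andP: b2_01. Qed.
Let p_gt0 : 0 < p. Proof. by case/andP: p01. Qed.
Let q_gt0 : 0 < 1 - p. Proof. by case/andP: p01; lra. Qed.

Definition letter (b : bool) : simil R := if b then (p, b1, b1) else (1 - p, b2, - b2).

(** The first letter of the word is the outermost map. *)
Definition wsim w : simil R := foldr (fun b => comp_simil (letter b)) (1, 1, 0) w.

Fixpoint words n : seq (seq bool) :=
  if n is n'.+1 then [seq b :: w | b <- [:: true; false], w <- words n'] else [:: [::]].

Lemma mem_words w : w \in words (size w).
Proof.
by elim: w => [|b w IH] //; apply/allpairsP; exists (b, w); split => //; case: b.
Qed.

Lemma size_words n w : w \in words n -> size w = n.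
Proof.
elim: n w => [|n IH] w; first by rewrite inE => /eqP ->.
by move=> /allpairsP[[b v] /= [_ /IH <- ->]].
Qed.

Lemma wt_wsim w : wt (wsim w) = p ^+ count id w * (1 - p) ^+ count negb w.
Proof.
elim: w => [|b w IH]; first by rewrite mulr1.
rewrite [LHS](_ : _ = wt (letter b) * wt (wsim w))// IH.
by case: b; rewrite /wt /= ?add0n ?add1n ?exprS; ring.
Qed.

Lemma rt_wsim w : rt (wsim w) = b1 ^+ count id w * b2 ^+ count negb w.
Proof.
elim: w => [|b w IH]; first by rewrite mulr1.
rewrite [LHS](_ : _ = rt (letter b) * rt (wsim w))// IH.
by case: b; rewrite /rt /= ?add0n ?add1n ?exprS; ring.
Qed.

Lemma wsim_bounds w : w != [::] -> [/\ 0 < wt (wsim w), 0 < rt (wsim w) & rt (wsim w) < 1].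
Proof.
rewrite wt_wsim rt_wsim !mulr_gt0 ?exprn_gt0// => w0; split => //.
have h1 k : b1 ^+ k <= 1 by rewrite exprn_ile1// ltW.
have h2 k : b2 ^+ k <= 1 by rewrite exprn_ile1// ltW.
case: w w0 => [//|[] w _] /=; rewrite ?add0n ?add1n exprS.
  by rewrite -mulrA (@le_lt_trans _ _ b1)// ger_pMr// mulr_ile1 ?exprn_ge0// ltW.
by rewrite mulrCA (@le_lt_trans _ _ b2)// ger_pMr// mulr_ile1 ?exprn_ge0// ltW.
Qed.

Lemma stationary_letters mu : self_similar p b1 b2 mu ->
  stationary mu [:: letter true; letter false].
Proof.
move=> h A mA; rewrite h// big_cons big_seq1 fineD; last 2 first.
- by rewrite fin_numM// fin_num_measure//; exact: (measurable_app_preimage (letter true)).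
- by rewrite fin_numM// fin_num_measure//; exact: (measurable_app_preimage (letter false)).
rewrite !fineM ?fin_num_measure//.
- exact: (measurable_app_preimage (letter false)).
- exact: (measurable_app_preimage (letter true)).
Qed.

Lemma map_wsim_words n : [seq wsim w | w <- words n.+1] =
  [seq comp_simil x y | x <- [:: letter true; letter false], y <- [seq wsim w | w <- words n]].
Proof. by rewrite /= !cats0 map_cat -!map_comp. Qed.

Lemma stationary_words mu n : self_similar p b1 b2 mu ->
  stationary mu [seq wsim w | w <- words n].
Proof.
move=> h; elim: n => [|n IH]; last first.
  by rewrite map_wsim_words; exact: stationary_comp (stationary_letters h) IH.
move=> A mA; rewrite big_seq1 /wt/= mul1r; congr (fine (mu _)).
by apply/seteqP; split => z; rewrite /app /rt /= mul1r addr0.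
Qed.

(** The case [d = 1]: Lyapunov exponent minus entropy. *)
Definition mean_excess l : R := \sum_(x <- l) wt x * (ln (wt x) - ln (rt x)).

(** Entropy and Lyapunov exponent are additive over independent letters. *)
Lemma mean_excess_words n : mean_excess [seq wsim w | w <- words n] =
  n%:R * (p * (ln p - ln b1) + (1 - p) * (ln (1 - p) - ln b2)).
Proof.
have total k : \sum_(w <- words k) wt (wsim w) = 1.
  elim: k => [|k IH]; first by rewrite big_seq1.
  have hb b : \sum_(w <- words k) wt (wsim (b :: w)) = wt (letter b).
    by rewrite -[RHS]mulr1 -IH mulr_sumr.
  by rewrite /= !cats0 big_cat !big_map !hb /wt /=; ring.
elim: n => [|n IH].
  by rewrite /mean_excess big_seq1 /wt /rt /= ln1; ring.
rewrite map_wsim_words /mean_excess big_allpairs_dep big_cons big_seq1.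
have step b : \sum_(y <- [seq wsim w | w <- words n])
    wt (comp_simil (letter b) y) * (ln (wt (comp_simil (letter b) y)) -
      ln (rt (comp_simil (letter b) y))) =
    wt (letter b) * ((ln (wt (letter b)) - ln (rt (letter b))) +
      mean_excess [seq wsim w | w <- words n]).
  rewrite -[ln (wt (letter b)) - _]mulr1 -(total n) mulr_sumr /mean_excess !big_map.
  rewrite -big_split mulr_sumr; apply: eq_bigr => w _ /=.
  have [lw lr] : 0 < wt (letter b) /\ 0 < rt (letter b) by case: b.
  have [ww wr] : 0 < wt (wsim w) /\ 0 < rt (wsim w).
    by rewrite wt_wsim rt_wsim !mulr_gt0 ?exprn_gt0.
  by rewrite wt_comp rt_comp !lnM ?posrE//; ring.
by rewrite !step IH /wt /rt /= -natr1; ring.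
Qed.

End words.

(** * Systems in which two maps coincide *)

Section merge.
Variable R : realType.
Implicit Types (x y : simil R) (l m : seq (simil R)) (mu : probability R R).

Lemma simil_eq x y : wt x = wt y -> rt x = rt y -> x.2 = y.2 -> x = y.
Proof. by case: x => [[? ?] ?]; case: y => [[? ?] ?]; rewrite /wt /rt /= => -> -> ->. Qed.

Definition double_wt x : simil R := (2 * wt x, rt x, x.2).

Lemma stationary_perm mu l m : perm_eq l m -> stationary mu l -> stationary mu m.
Proof. by move=> lm h A mA; rewrite h// (perm_big m). Qed.

Lemma stationary_merge mu x l : stationary mu [:: x, x & l] -> stationary mu (double_wt x :: l).
Proof.
move=> h A mA; rewrite h// !big_cons [app (double_wt x)](_ : _ = app x)//.
by rewrite [wt (double_wt x)](_ : _ = 2 * wt x)//; ring.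
Qed.

(** Only the weight inside the logarithm changes, and [ln (2 w) = ln 2 + ln w]. *)
Lemma mean_excess_merge x l : 0 < wt x ->
  mean_excess (double_wt x :: l) = mean_excess [:: x, x & l] + 2 * wt x * ln 2.
Proof.
move=> w0; rewrite /mean_excess !big_cons [wt (double_wt x)](_ : _ = 2 * wt x)//.
by rewrite [rt (double_wt x)](_ : _ = rt x)// lnM ?posrE//; ring.
Qed.

End merge.

(** * Choice of the probability by the intermediate value theorem *)

Lemma exists_weight (R : realType) (b1 b2 : R) (n a c : nat) : (0 < n)%N ->
  0 < b1 < 1 -> 0 < b2 < 1 -> 1 < b1 + b2 ->
  exists2 p : R, 0 < p < 1 &
    let D := p * (ln p - ln b1) + (1 - p) * (ln (1 - p) - ln b2) in
    D < 0 /\ 0 < n%:R * D + 2 * (p ^+ a * (1 - p) ^+ c) * ln 2.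
Proof.
move=> n0 /andP[b10 b11] /andP[b20 b21] b12.
pose D p : R := p * (ln p - ln b1) + (1 - p) * (ln (1 - p) - ln b2).
pose q p : R := p ^+ a * (1 - p) ^+ c.
(* Half of the entropy gain is used, so that a zero of [h] gives both strict inequalities: there
   [n D = - q ln 2 < 0], while [n D + 2 q ln 2 = q ln 2 > 0]. *)
pose h p := n%:R * D p + q p * ln 2.
have nR : 0 < n%:R :> R by rewrite ltr0n.
have ln20 : 0 < ln 2 :> R by rewrite ln_gt0// ltr1n.
have q0 p : 0 < p < 1 -> 0 < q p * ln 2.
  by move=> /andP[p0 p1]; rewrite mulr_gt0// mulr_gt0// exprn_gt0// subr_gt0.
have bb0 : 0 < b1 + b2 by lra.
pose p0 := b1 / (b1 + b2).
have p0q : 1 - p0 = b2 / (b1 + b2) by rewrite /p0; field; lra.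
have p00 : 0 < p0 by rewrite divr_gt0.
have p01 : p0 < 1 by rewrite -subr_gt0 p0q divr_gt0.
have Dp0 : D p0 < 0.
  have -> : D p0 = - ln (b1 + b2).
    rewrite /D p0q /p0 !ln_div ?posrE//.
    have e : 1 = b1 / (b1 + b2) + b2 / (b1 + b2) :> R by field; lra.
    by rewrite -[RHS]mul1r [in RHS]e; ring.
  by rewrite oppr_lt0 ln_gt0.
have [hp0|hp0] := leP 0 (h p0).
  exists p0; first by rewrite p00.
  split => //; have := q0 _ (introT andP (conj p00 p01)).
  by move: hp0; rewrite /h /D /q; lra.
(* At [p1] one has [D p1 >= 0]: the main term [- (1 - p1) * ln b2] is at least [8 x (1 - p1)], and
   the entropy terms cost at most [2 x + p1]. With [p1] a square, [p1 * ln p1 = 2 x^2 ln x] is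
   bounded linearly in [x] through [ln z >= 1 - 1 / z]. *)
pose x := (1 - b2) / 8; pose p1 := x ^+ 2.
have x0 : 0 < x by rewrite /x; lra.
have x1 : x <= 1 / 8 by rewrite /x; lra.
have p1x : p1 <= x / 8 by rewrite /p1; nra.
have p10 : 0 < p1 by rewrite exprn_gt0.
have p1p0 : p1 <= p0.
  rewrite /p0 ler_pdivlMr//; have : p1 * (b1 + b2) <= p1 * 2 by rewrite ler_pM2l//; lra.
  by rewrite /x in p1x *; lra.
have ln_ge z : 0 < z -> 1 - z^-1 <= ln z.
  move=> z0; have zi : 0 < z^-1 by rewrite invr_gt0.
  have : ln (1 + (z^-1 - 1)) <= z^-1 - 1 by rewrite le_ln1Dx//; lra.
  by rewrite subrKC lnV ?posrE//; lra.
have hp1 : 0 < h p1.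
  rewrite ltr_wpDl ?q0 ?p10//=; last by rewrite (le_lt_trans p1p0).
  rewrite mulr_ge0 ?(ltW nR)//.
  have e1 : - 2 * x <= p1 * ln p1.
    rewrite /p1 expr2 lnM ?posrE//.
    have : x * (1 - x^-1) <= x * ln x by rewrite ler_pM2l// ln_ge.
    by rewrite mulrBr divff ?gt_eqF// mulr1; nra.
  have e2 : - p1 <= (1 - p1) * ln (1 - p1).
    have p11 : 0 < 1 - p1 by lra.
    have : (1 - p1) * (1 - (1 - p1)^-1) <= (1 - p1) * ln (1 - p1).
      by rewrite ler_pM2l// ln_ge.
    by rewrite mulrBr divff ?gt_eqF// mulr1; lra.
  have e3 : ln b1 <= 0 by rewrite ln_le0// ltW.
  have e4 : ln b2 <= b2 - 1.
    have : ln (1 + (b2 - 1)) <= b2 - 1 by rewrite le_ln1Dx//; lra.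
    by rewrite subrKC.
  have e5 : p1 * ln b1 <= 0 by rewrite pmulr_rle0.
  have e6 : (1 - p1) * ln b2 <= (1 - p1) * (b2 - 1) by rewrite ler_pM2l//; lra.
  have e7 : 8 * x = 1 - b2 by rewrite /x; field.
  rewrite /D mulrBr [X in _ <= _ + X]mulrBr.
  have : b2 - 1 = - (8 * x) by lra.
  by move=> e8; rewrite e8 in e6; nra.
have ch : {within `[p1, p0], continuous h}.
  apply: continuous_in_subspaceT => z; rewrite inE /= in_itv/= => /andP[z1 z2].
  have z0 : 0 < z by lra.
  have z3 : 0 < 1 - z by lra.
  have c1 : {for z, continuous (fun y : R => 1 - y)}.
    by apply: cvgB; [exact: cvg_cst|exact: cvg_id].
  have c2 : {for z, continuous (fun y : R => ln (1 - y))}.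
    by apply: (@continuous_comp _ _ _ (fun y : R => 1 - y) (@ln R)) => //;
      exact: continuous_ln.
  have c3 : {for z, continuous (@ln R)} by exact: continuous_ln.
  apply: cvgD; last first.
    apply: cvgM; last exact: cvg_cst.
    apply: cvgM; first exact: exprn_continuous.
    apply: (@continuous_comp _ _ _ (fun y : R => 1 - y) (fun y => y ^+ c)) => //.
    exact: exprn_continuous.
  apply: cvgM; first exact: cvg_cst.
  apply: cvgD; apply: cvgM => //.
  - by apply: cvgB => //; exact: cvg_cst.
  - by apply: cvgB => //; exact: cvg_cst.
have [|z] := IVT p1p0 ch (v := 0).
  by rewrite ge_min le_max (ltW hp1) (ltW hp0) orbT.
rewrite in_itv/= => /andP[z1 z2] hz; have z01 : 0 < z < 1 by apply/andP; split; lra.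
exists z => //; have := q0 _ z01; rewrite /h in hz => qz; split.
  by rewrite -(pmulr_rlt0 _ nR); rewrite -/(D z); lra.
by rewrite -/(D z) -/(q z); lra.
Qed.

(** * The curve equation as an equality of translation parts of words *)

Section curve.
Variable R : realType.

Definition word n (s : 'I_n -> int) : seq bool := [seq s i == 1 | i <- enum 'I_n].

Lemma size_word n (s : 'I_n -> int) : size (word s) = n.
Proof. by rewrite size_map size_enum_ord. Qed.

Lemma word_recl n (s : 'I_n.+1 -> int) :
  word s = (s ord0 == 1) :: word (s \o lift ord0).
Proof. by rewrite /word enum_ordSl /= -map_comp. Qed.

Lemma count_word n (s : 'I_n -> int) : count id (word s) = #|[pred i : 'I_n | s i == 1]|.
Proof. by rewrite count_map -sum1_count -sum1_card big_enum_cond. Qed.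

Lemma sharpE n (s : 'I_n -> int) k :
  sharp s k = (\sum_(i < n) ((i <= k) && (s i == 1)))%N.
Proof.
rewrite /sharp -sum1_card big_mkcond; apply: eq_bigr => i _.
by rewrite inE; case: ifP.
Qed.

Lemma sharp0 n (s : 'I_n.+1 -> int) : sharp s 0 = (s ord0 == 1).
Proof. by rewrite sharpE big_ord_recl big1 ?addn0. Qed.

Lemma sharpS n (s : 'I_n.+1 -> int) k :
  sharp s k.+1 = ((s ord0 == 1) + sharp (s \o lift ord0) k)%N.
Proof. by rewrite !sharpE big_ord_recl. Qed.

(** Makes the truncated subtraction [k.+1 - sharp s k] the true number of entries [-1]. *)
Lemma sharp_le n (s : 'I_n -> int) k : (sharp s k <= k.+1)%N.
Proof.
elim: n s k => [|n IH] s k; first by rewrite sharpE big_ord0.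
case: k => [|k]; first by rewrite sharp0; case: eqP.
by rewrite sharpS (leq_trans (leq_add (leq_b1 _) (IH _ k))).
Qed.

(** Induction on the first letter: it contributes its own translation and multiplies all later terms
    by its ratio, which raises one of the two exponents by one. *)
Lemma trans_word (p b1 b2 : R) n (s : 'I_n -> int) : (forall i, s i = 1 \/ s i = -1) ->
  (wsim p b1 b2 (word s)).2 =
  \sum_(k < n) (s k)%:~R * b1 ^+ sharp s k * b2 ^+ (k.+1 - sharp s k).
Proof.
elim: n s => [|n IH] s hs; first by rewrite big_ord0 /word enum_ord0.
rewrite word_recl big_ord_recl /= IH; last by move=> i; exact: hs.
rewrite sharp0 addrC mulr_sumr; congr (_ + _).
  by case: (hs ord0) => ->; rewrite /=; ring.
apply: eq_bigr => k _; rewrite /bump /= add1n sharpS.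
have := sharp_le (s \o lift ord0) k.
case: (hs ord0) => -> /= hk; first by rewrite add1n subSS exprS /rt /=; ring.
by rewrite add0n (subSn hk) exprS /rt /=; ring.
Qed.

End curve.

(** * Merging the two coinciding words and concluding *)

Theorem theorem1p2 (R : realType) (n : nat) (s t : 'I_n -> int) (b1 b2 : R) :
  (3 <= n)%N ->
  (forall i, s i = 1 \/ s i = -1) ->
  (forall i, t i = 1 \/ t i = -1) ->
  s <> t ->
  #|[pred i : 'I_n | s i == 1]| = #|[pred i : 'I_n | t i == 1]| ->
  0 < b1 < 1 -> 0 < b2 < 1 ->
  1 < b1 + b2 ->
  curve_poly s t b1 b2 = 0 ->
  exists p : R, 0 < p < 1 /\ 1 < SD p b1 b2 /\
    (exists mu : probability R R, self_similar p b1 b2 mu) /\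
    (forall mu : probability R R, self_similar p b1 b2 mu ->
       singular_lebesgue mu /\ (hausdorff_dim_measure mu < 1%:E)%E).
Proof.
move=> n3 hs ht st cst b1_01 b2_01 b12 curve.
have n0 : (0 < n)%N by exact: leq_trans n3.
have [p p01 /= [D0 Dq]] := exists_weight (count id (word s)) (count negb (word s))
  n0 b1_01 b2_01 b12.
exists p; split => //; split; last split; last 1 first.
- move=> mu hmu.
  have ccount : count id (word s) = count id (word t) by rewrite !count_word.
  have ccountN : count negb (word s) = count negb (word t).
    apply/eqP; rewrite -(eqn_add2l (count id (word s))) {2}ccount.
    by rewrite !count_predC !size_word.
  (* Equal letter counts give equal weights and ratios; the curve equation gives equal
     translations. *)
  have ust : wsim p b1 b2 (word t) = wsim p b1 b2 (word s).
    apply: simil_eq; rewrite ?wt_wsim ?rt_wsim ?ccount ?ccountN//.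
    by rewrite !trans_word//; apply/esym/eqP; rewrite -subr_eq0 -sumrB; exact/eqP.
  have wst : word t != word s.
    apply/eqP => /esym/eq_in_map wst; apply: st; apply/funext => i.
    have := wst i; rewrite mem_enum => /(_ isT).
    by case: (hs i) => ->; case: (ht i) => ->.
  have ins : word s \in words n by rewrite -{2}(size_word s) mem_words.
  have int : word t \in words n by rewrite -{2}(size_word t) mem_words.
  have intr : word t \in rem (word s) (words n) by exact: rem_mem.
  set r := rem (word t) (rem (word s) (words n)).
  have pw : perm_eq (words n) [:: word s, word t & r].
    by rewrite (perm_trans (perm_to_rem ins))// perm_cons perm_to_rem.
  have pl : perm_eq [seq wsim p b1 b2 w | w <- words n]
      [:: wsim p b1 b2 (word s), wsim p b1 b2 (word s) & [seq wsim p b1 b2 w | w <- r]].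
    (* The words [s] and [t] are distinct entries of [words n], but carry the same map. *)
    by rewrite -[X in [:: _, X & _]]ust; exact: perm_map pw.
  have wbounds w : w \in words n -> [/\ 0 < wt (wsim p b1 b2 w),
      0 < rt (wsim p b1 b2 w) & rt (wsim p b1 b2 w) < 1].
    move=> /size_words sw; apply: wsim_bounds => //.
    by rewrite -size_eq0 sw -lt0n.
  have [w0 r0 r1] := wbounds _ ins.
  apply: (@stationary_dim_lt1 _ _ (double_wt (wsim p b1 b2 (word s)) ::
    [seq wsim p b1 b2 w | w <- r])).
  + exact/stationary_merge/(stationary_perm pl)/stationary_words.
  + move=> x; rewrite inE => /predU1P[->|/mapP[w wr ->]].
      by rewrite /double_wt; split => //; rewrite mulr_gt0.
    by apply: wbounds; rewrite (perm_mem pw) !inE wr !orbT.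
  (* The merged mean excess is [n D + 2 q ln 2], positive by [Dq]. *)
  + rewrite -/(mean_excess _) mean_excess_merge// /mean_excess -(perm_big _ pl).
    by rewrite -/(mean_excess _) mean_excess_words// wt_wsim.
(* Both logarithms are negative, so the denominator of [SD] is positive; clearing it turns the claim
   into [D0]. *)
- case/andP: (p01) (b1_01) (b2_01) => p0 p1 /andP[b10 b11] /andP[b20 b21].
  rewrite /SD ltr_pdivlMr ?mul1r; first by lra.
  have : ln b1 < 0 by rewrite ln_lt0// b10.
  have : ln b2 < 0 by rewrite ln_lt0// b20.
  by nra.
- exact: self_similar_exists.
Qed.
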